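(* Let $J=[0,\infty)$, let $f:J\to\mathbb{R}$ be a function that is differentiable on $J^{\circ}=(0,\infty)$, and let $a,b\in J$ with $0<a<b$ and $f'\in L[a,b]$. Let $q>1$ and let $p$ satisfy $\frac1p+\frac1q=1$. If $|f'|^{q}$ is convex on $[a,b]$, then $$\left|\frac{1}{b-a}\int_{a}^{b}f(x)\,dx+\frac{a f(b)-b f(a)}{2(b-a)}-\frac12 f\left(\frac{a+b}{2}\right)\right|$$ $$\le\frac{1}{4^{1+1/q}}L_{p}(a,b)\left[\bigl(|f'(b)|^{q}+3|f'(a)|^{q}\bigr)^{1/q}+\bigl(|f'(a)|^{q}+3|f'(b)|^{q}\bigr)^{1/q}\right].$$
   Context: $L[a,b]$ denotes the space of (Lebesgue) integrable functions on $[a,b]$. The generalized logarithmic mean of $a,b>0$, $a\ne b$, is $L_{p}(a,b)=\left(\frac{b^{p+1}-a^{p+1}}{(p+1)(b-a)}\right)^{1/p}$ for real $p\neq -1,0$. *)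

(* Defs.v *)
From HB Require Import structures.
From mathcomp Require Import all_boot all_order all_algebra.
From mathcomp Require Import all_classical all_reals all_analysis.

Set Implicit Arguments.
Unset Strict Implicit.
Unset Printing Implicit Defensive.

Import Order.TTheory GRing.Theory Num.Theory.
Import numFieldNormedType.Exports.

Local Open Scope classical_set_scope.
Local Open Scope ring_scope.

(* The generalized logarithmic mean $L_p(a, b)$. It is meant for $a, b > 0$,
   $a \ne b$ and $p \ne -1, 0$, when the base of the outer power is positive;
   elsewhere the value is an artefact of the totality of [`^] and of division. *)
Definition gen_log_mean (R : realType) (p a b : R) : R :=
  ((b `^ (p + 1) - a `^ (p + 1)) / ((p + 1) * (b - a))) `^ p^-1.

(* Main.v *)
(* With m = (a + b) / 2, w = 2 a + b on [a, m] and w = a + 2 b on [m, b], and F a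
   primitive of f, the function 2 F + (w - 2 x) f has derivative (w - 2 x) f',
   and its two increments add up to 2 (b - a) times the quantity to estimate.
   Each increment is bounded by comparing this derivative, through Young's
   inequality, with s^p (w - 2 x)^p / p + s^(-q) l(x) / q, where l is the chord
   of the convex function |f'|^q, and optimizing over s > 0.  The bounding
   functions have explicit primitives, so f' itself is never integrated. *)
Require Import Defs.
From HB Require Import structures.
From mathcomp Require Import all_boot all_order all_algebra.
From mathcomp Require Import all_classical all_reals all_analysis.
From mathcomp Require Import ring lra.

Set Implicit Arguments.
Unset Strict Implicit.
Unset Printing Implicit Defensive.

Import Order.TTheory GRing.Theory Num.Theory.
Import numFieldNormedType.Exports.

Local Open Scope classical_set_scope.
Local Open Scope ring_scope.

(** Both [G - g] and [G + g] have nonnegative derivatives, so the mean value theorem makes their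
    increments nonnegative. No integrability of [dg] enters. *)
Lemma norm_increment_le (R : realType) (g G dg dG : R -> R) (c d : R) :
  c <= d ->
  {in `[c, d], forall x : R, is_derive x 1 g (dg x)} ->
  {in `[c, d], forall x : R, is_derive x 1 G (dG x)} ->
  {in `[c, d], forall x, `|dg x| <= dG x} ->
  `|g d - g c| <= G d - G c.
Proof.
move=> cd Dg DG dgG.
have [| |z zcd] := @MVT_segment _ (G - g) (dG - dg) c d cd.
- move=> x /subset_itv_oo_cc xcd.
  by apply: is_deriveB; [exact: DG|exact: Dg].
- apply: derivable_within_continuous => x xcd.
  by apply: derivableB; apply: ex_derive; [exact: DG|exact: Dg].
have [| |y ycd] := @MVT_segment _ (G + g) (dG + dg) c d cd.
- move=> x /subset_itv_oo_cc xcd.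
  by apply: is_deriveD; [exact: DG|exact: Dg].
- apply: derivable_within_continuous => x xcd.
  by apply: derivableD; apply: ex_derive; [exact: DG|exact: Dg].
have := dgG _ zcd; have := dgG _ ycd; rewrite !ler_norml !fctE.
move=> /andP[y1 y2] /andP[z1 z2] Ey Ez.
have : 0 <= (dG y + dg y) * (d - c) by rewrite mulr_ge0; lra.
have : 0 <= (dG z - dg z) * (d - c) by rewrite mulr_ge0; lra.
by move=> h1 h2; apply/andP; split; lra.
Qed.

(** Young's inequality with a free scale [s] bounds [x] by a family of sums whose infimum over [s]
    is the Hölder product. For [Q = 0] this infimum is 0 and is not attained, hence the separate
    case. *)
Lemma le_powR_mul_of_young (R : realType) (p q P Q x : R) :
  0 < p -> 0 < q -> p^-1 + q^-1 = 1 -> 0 < P -> 0 <= Q ->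
  (forall s, 0 < s -> x <= s `^ p * P / p + (s `^ q)^-1 * Q / q) ->
  x <= P `^ p^-1 * Q `^ q^-1.
Proof.
move=> p0 q0 pq P0 + H; rewrite le_eqVlt => /predU1P[Q0|Q0].
  rewrite -{Q}Q0 in H *; rewrite powR0 ?gt_eqF ?invr_gt0// mulr0 leNgt.
  apply/negP => x0.
  (* If [x > 0], the scale with [s^p = x p / (2 P)] turns the hypothesis into [x <= x / 2]. *)
  have y0 : 0 < x * p / (2 * P) by rewrite divr_gt0 ?mulr_gt0.
  have := H ((x * p / (2 * P)) `^ p^-1) (powR_gt0 _ y0).
  rewrite mulr0 mul0r addr0 -powRrM mulVf ?gt_eqF// powRr1 ?(ltW y0)//.
  have -> : x * p / (2 * P) * P / p = x / 2.
    by field; rewrite !gt_eqF.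
  by move=> xle; move: x0; rewrite ltNge => /negP; apply; lra.
have QP0 : 0 < Q / P by rewrite divr_gt0.
(* The minimizing scale: here [s^p P] and [s^(-q) Q] both equal [P^(1/p) Q^(1/q)], and the weights
   [1/p], [1/q] add up to 1. *)
have := H ((Q / P) `^ (p^-1 * q^-1)) (powR_gt0 _ QP0).
have pE : p^-1 = 1 - q^-1 by rewrite -pq addrK.
have powE (r y : R) : 0 < y -> y `^ (1 - r) = y / y `^ r.
  by move=> y0; rewrite powRB ?powRr1 ?ltW// (gt_eqF y0) implybT.
have divE (r : R) : (Q / P) `^ r = Q `^ r / P `^ r.
  by rewrite powRM ?invr_ge0 ?ltW// -powR_inv1 ?ltW// -powRrM mulN1r powRN.
rewrite -!powRrM mulfVK ?gt_eqF// (mulrAC _ _ p) mulVf ?gt_eqF// mul1r !divE.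
rewrite pE (powE _ _ P0) (powE _ _ Q0) -pE.
have Pq := powR_gt0 q^-1 P0; have Qq := powR_gt0 q^-1 Q0.
move=> /le_trans; apply; rewrite le_eqVlt; apply/orP; left; apply/eqP.
transitivity (P / P `^ q^-1 * Q `^ q^-1 * (p^-1 + q^-1)); last by rewrite pq mulr1.
by field; rewrite !gt_eqF.
Qed.

(* Hölder's inequality with the integrals replaced by increments of primitives,
   so that [dg] need not be integrable. *)
Lemma hoelder_increment (R : realType) (g U V dg u w v : R -> R) (c d p q : R) :
  c <= d -> 0 < p -> 0 < q -> p^-1 + q^-1 = 1 ->
  {in `[c, d], forall x : R, is_derive x 1 g (dg x)} ->
  {in `[c, d], forall x : R, is_derive x 1 U (u x `^ p)} ->
  {in `[c, d], forall x : R, is_derive x 1 V (v x)} ->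
  {in `[c, d], forall x, [/\ 0 <= u x, 0 <= w x & w x `^ q <= v x]} ->
  {in `[c, d], forall x, `|dg x| <= u x * w x} ->
  0 < U d - U c -> 0 <= V d - V c ->
  `|g d - g c| <= (U d - U c) `^ p^-1 * (V d - V c) `^ q^-1.
Proof.
move=> cd p0 q0 pq Dg DU DV uwv dguw U0 V0.
apply: le_powR_mul_of_young => // s s0.
have -> : s `^ p * (U d - U c) / p + (s `^ q)^-1 * (V d - V c) / q =
    ((s `^ p / p) *: U + ((s `^ q)^-1 / q) *: V) d -
    ((s `^ p / p) *: U + ((s `^ q)^-1 / q) *: V) c.
  by rewrite !fctE /GRing.scale/=; lra.
apply: (@norm_increment_le _ _ _ _
    (fun x => (s `^ p / p) *: (u x `^ p) + ((s `^ q)^-1 / q) *: v x) _ _ cd Dg).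
  move=> x xcd; have := DU _ xcd; have := DV _ xcd => ? ?.
  exact: is_deriveD.
move=> x xcd; apply: le_trans (dguw _ xcd) _; have [ux wx wv] := uwv _ xcd.
(* Rescaling by [s] keeps the product [u w] but shifts weight between the two terms of Young's
   inequality. *)
have := @conjugate_powR _ (s * u x) (w x / s) p q.
rewrite mulr_ge0 ?divr_ge0 ?(ltW s0)// => /(_ isT isT p0 q0 pq).
have is0 : 0 <= s^-1 by rewrite invr_ge0 ltW.
rewrite (powRM _ (ltW s0) ux) (powRM _ wx is0).
have -> : s^-1 `^ q = (s `^ q)^-1.
  by rewrite -(powR_inv1 (ltW s0)) -powRrM mulN1r powRN.
have -> : s * u x * (w x / s) = u x * w x by field; rewrite gt_eqF.
move=> /le_trans; apply; rewrite /GRing.scale/= [leLHS](_ : _ =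
  s `^ p / p * u x `^ p + (s `^ q)^-1 / q * w x `^ q); last lra.
by rewrite lerD2l ler_wpM2l// divr_ge0 ?invr_ge0 ?powR_ge0// ltW.
Qed.

(** The integral with variable upper limit works; its two-sided derivative is available only in the
    open interval. *)
Lemma continuous_primitive (R : realType) (f : R -> R) (l u : R) :
  l < u -> {within `[l, u], continuous f} ->
  {in `]l, u[, continuous f} ->
  exists F : R -> R, {in `]l, u[, forall x : R, is_derive x 1 F (f x)}.
Proof.
move=> lu cf cfo.
have fi : (@lebesgue_measure R).-integrable `[l, u] (EFin \o f).
  by apply: continuous_compact_integrable => //; exact: segment_compact.
exists (fun x => \int[@lebesgue_measure R]_(t in `[l, x]) f t)%R => x xlu.
have := xlu; rewrite in_itv/= => /andP[lx xu].
have [dF <-] := continuous_FTC1_closed xu fi lx (cfo _ xlu).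
by rewrite derive1E; exact/derivableP.
Qed.

Lemma convex_function_le_chord (R : realType) (h : R -> R) (a b : R) : a < b ->
  convex_function (`[a, b]%classic : set R) h ->
  {in `[a, b], forall x : R, h x <= h a + (h b - h a) / (b - a) * (x - a)}.
Proof.
move=> ab cvxh x /[!in_itv]/= /andP[ax xb].
have ba0 : 0 < b - a by rewrite subr_gt0.
have t0 : 0 <= (b - x) / (b - a) by rewrite divr_ge0 ?(ltW ba0)// subr_ge0.
have t1 : (b - x) / (b - a) <= 1 by rewrite ler_pdivrMr// mul1r; lra.
have aI : a \in (`[a, b]%classic : set R) by rewrite inE/= in_itv/= lexx ltW.
have bI : b \in (`[a, b]%classic : set R) by rewrite inE/= in_itv/= lexx ltW.
pose t := (b - x) / (b - a).
have xE : t * a + (1 - t) * b = x by rewrite /t; field; rewrite gt_eqF.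
have : h (t * a + (1 - t) * b) <= t * h a + (1 - t) * h b.
  exact: cvxh (Itv01 t0 t1) a b aI bI.
rewrite xE => /le_trans; apply; rewrite le_eqVlt; apply/orP; left; apply/eqP.
by rewrite /t; field; rewrite gt_eqF.
Qed.

(* On each half of [a, b] the kernel [w - 2 x] decreases from [b] to [a]. *)
Lemma kernel_increment_le (R : realType) (f F : R -> R) (a b c d w p q C D : R) :
  0 < a -> a < b -> w - 2 * c = b -> w - 2 * d = a ->
  0 < p -> 0 < q -> p^-1 + q^-1 = 1 ->
  {in `[c, d], forall x : R, is_derive x 1 F (f x)} ->
  {in `[c, d], forall x : R, derivable f x 1} ->
  {in `[c, d], forall x : R, `|derive1 f x| `^ q <= C + D * x} ->
  `| 2 * (F d - F c) + (a * f d - b * f c) | <=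
  ((b `^ (p + 1) - a `^ (p + 1)) / (2 * (p + 1))) `^ p^-1 *
  ((d - c) * (C + D * ((c + d) / 2))) `^ q^-1.
Proof.
move=> a0 ab wc wd p0 q0 pq DF Df fle.
have cd : c <= d by lra.
have p10 : 0 < p + 1 by lra.
have wx0 x : x \in `[c, d] -> 0 < w - 2 * x.
  by rewrite in_itv/= => /andP[cx xd]; lra.
pose k : R -> R := fun x => w - 2 * x.
have Dk (x : R) : is_derive x 1 k (- 2).
  rewrite /k; apply: is_derive_eq.
  by rewrite /GRing.scale/=; lra.
(* Differentiating [k * f] produces [- 2 f], which the term [2 F] cancels; what remains is
   [k f']. *)
pose g : R -> R := 2 \*: F + k * f.
pose U : R -> R := fun x => - (2 * (p + 1))^-1 * (k x) `^ (p + 1).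
pose V : R -> R := fun x => C * x + D / 2 * x ^+ 2.
have Dg : {in `[c, d], forall x : R, is_derive x 1 g (k x * derive1 f x)}.
  move=> x xcd; have ? := DF _ xcd.
  have ? : is_derive x 1 f (derive1 f x).
    by rewrite derive1E; exact/derivableP/Df.
  rewrite /g; apply: is_derive_eq.
  by rewrite /GRing.scale/=; lra.
have DU : {in `[c, d], forall x : R, is_derive x 1 U (k x `^ p)}.
  move=> x xcd; have kx0 : 0 < k x by exact: wx0.
  have := is_derive1_powR (p + 1) kx0; rewrite addrK => Dpow.
  have ? := is_derive1_comp Dpow (Dk x).
  have -> : U = (- (2 * (p + 1))^-1) \*: ((fun y : R => y `^ (p + 1)) \o k).
    by [].
  apply: is_derive_eq.
  by rewrite /GRing.scale/=; field; rewrite gt_eqF.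
have DV : {in `[c, d], forall x : R, is_derive x 1 V (C + D * x)}.
  move=> x xcd; rewrite /V; apply: is_derive_eq.
  by rewrite /GRing.scale/=; field.
have UE : U d - U c = (b `^ (p + 1) - a `^ (p + 1)) / (2 * (p + 1)).
  by rewrite /U /k wc wd; field; rewrite gt_eqF.
(* The midpoint rule is exact for an affine integrand. *)
have VE : V d - V c = (d - c) * (C + D * ((c + d) / 2)).
  by rewrite /V; field.
have gE : g d - g c = 2 * (F d - F c) + (a * f d - b * f c).
  by rewrite /g !fctE /k/= wc wd /GRing.scale/=; ring.
have cI : c \in `[c, d] by rewrite in_itv/= lexx.
have dI : d \in `[c, d] by rewrite in_itv/= lexx cd.
rewrite -gE -UE -VE.
apply: (hoelder_increment (w := fun x => `|derive1 f x|) cd p0 q0 pq Dg DU DV).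
- by move=> x xcd; split => //; [exact/ltW/wx0|exact: fle].
- by move=> x xcd; rewrite normrM gtr0_norm//; exact: wx0.
- rewrite UE divr_gt0 ?mulr_gt0// subr_gt0 gt0_ltr_powR// nnegrE ltW//.
  exact: lt_trans ab.
- rewrite VE mulr_ge0 ?subr_ge0//.
  (* The affine bound at the midpoint is the mean of its values at [c] and [d], each of which
     dominates a power and so is nonnegative. *)
  have := le_trans (powR_ge0 _ _) (fle _ cI).
  have := le_trans (powR_ge0 _ _) (fle _ dI).
  lra.
Qed.

Theorem theorem6 (R : realType) (f : R -> R) (a b p q : R)
    (derf : forall x : R, x \in `]0, +oo[ -> derivable f x 1)
    (a_gt0 : 0 < a) (ab : a < b)
    (intf' : (@lebesgue_measure R).-integrable `[a, b] (EFin \o derive1 f))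
    (q_gt1 : 1 < q) (pq : p^-1 + q^-1 = 1)
    (cvxf' : convex_function (`[a, b]%classic : set R)
               (fun x : R => `|derive1 f x| `^ q)) :
  `| (b - a)^-1 * (\int[@lebesgue_measure R]_(x in `[a, b]) f x)%R
     + (a * f b - b * f a) / (2 * (b - a))
     - 2^-1 * f ((a + b) / 2) |
  <= (4 `^ (1 + q^-1))^-1 * gen_log_mean p a b *
     ((`|derive1 f b| `^ q + 3 * `|derive1 f a| `^ q) `^ q^-1
      + (`|derive1 f a| `^ q + 3 * `|derive1 f b| `^ q) `^ q^-1).
Proof.
have ba0 : 0 < b - a by rewrite subr_gt0.
have q0 : 0 < q by rewrite (lt_trans ltr01).
have p0 : 0 < p.
  have : q^-1 < 1 by rewrite invf_lt1.
  by rewrite -invr_gt0; lra.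
have b0 : 0 < b by rewrite (lt_trans a_gt0).
have cf (x : R) : 0 < x -> {for x, continuous f}.
  move=> x0; apply/differentiable_continuous/derivable1_diffP/derf.
  by rewrite in_itv/= andbT.
have cfab (l u : R) : 0 < l -> {within `[l, u], continuous f}.
  move=> l0; apply: derivable_within_continuous => x.
  rewrite in_itv/= => /andP[lx _]; apply: derf.
  by rewrite in_itv/= andbT (lt_le_trans l0).
have [F DF] : exists F : R -> R,
    {in `[a, b], forall x : R, is_derive x 1 F (f x)}.
  (* This interval contains [[a, b]] in its interior and stays in the positive reals, so [F] is
     differentiable from both sides at [a] and [b] too. *)
  have [||x|F DF] := @continuous_primitive _ f (a / 2) (b + 1).
  - by lra.
  - by apply: cfab; lra.
  - by rewrite in_itv/= => /andP[ax xb]; apply: cf; lra.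
  exists F => x; rewrite in_itv/= => /andP[ax xb].
  by apply: DF; rewrite in_itv/=; apply/andP; split; lra.
have intE : \int[@lebesgue_measure R]_(x in `[a, b]) f x = F b - F a.
  rewrite /Rintegral (@continuous_FTC2 _ f F)//.
  - exact: cfab.
  - have cF : {in `[a, b], continuous F}.
      move=> x xab; apply/differentiable_continuous/derivable1_diffP.
      by have [] := DF x xab.
    split=> [x /subset_itv_oo_cc xab||]; first by have [] := DF x xab.
      by apply/cvg_at_right_filter/cF; rewrite in_itv/= lexx ltW.
    by apply/cvg_at_left_filter/cF; rewrite in_itv/= lexx ltW.
  - move=> x xab; rewrite derive1E; have := DF x (subset_itv_oo_cc xab).
    by move=> ?; rewrite derive_val.
set A := `|derive1 f a| `^ q; set B := `|derive1 f b| `^ q.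
have A0 : 0 <= A by exact: powR_ge0.
have B0 : 0 <= B by exact: powR_ge0.
pose D := (B - A) / (b - a).
have fle : {in `[a, b], forall x : R, `|derive1 f x| `^ q <= (A - D * a) + D * x}.
  move=> x xab; have := convex_function_le_chord ab cvxf' xab.
  by rewrite -/A -/B -/D; lra.
pose m := (a + b) / 2.
have half (c d w : R) : w - 2 * c = b -> w - 2 * d = a -> a <= c -> d <= b ->
    `| 2 * (F d - F c) + (a * f d - b * f c) | <=
    (b - a) / 2 * gen_log_mean p a b * (A + D * ((c + d) / 2 - a)) `^ q^-1.
  move=> wc wd ac db.
  have sub : {subset `[c, d] <= `[a, b]}.
    move=> x; rewrite !in_itv/= => /andP[cx xd].
    by apply/andP; split; lra.
  have dfx x : x \in `[c, d] -> derivable f x 1.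
    move/sub; rewrite in_itv/= => /andP[ax _]; apply: derf.
    by rewrite in_itv/= andbT (lt_le_trans a_gt0).
  apply: le_trans (kernel_increment_le a_gt0 ab wc wd p0 q0 pq
    (fun x xcd => DF x (sub x xcd)) dfx (fun x xcd => fle x (sub x xcd))) _.
  have -> : d - c = (b - a) / 2 by lra.
  have -> : (b `^ (p + 1) - a `^ (p + 1)) / (2 * (p + 1)) = (b - a) / 2 *
      ((b `^ (p + 1) - a `^ (p + 1)) / ((p + 1) * (b - a))).
    by field; rewrite !gt_eqF//; lra.
  have h0 : 0 < (b - a) / 2 by lra.
  (* The half-length occurs once under each root; as the exponents add up to 1, it comes out whole
     and leaves [gen_log_mean p a b]. *)
  have hE : ((b - a) / 2) `^ p^-1 * ((b - a) / 2) `^ q^-1 = (b - a) / 2.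
    by rewrite -powRD pq ?powRr1 ?oner_eq0// ltW.
  rewrite powRM ?(ltW h0)//; last first.
    rewrite divr_ge0 ?mulr_ge0 ?(ltW ba0) ?subr_ge0//; last lra.
    by apply: ltW; rewrite gt0_ltr_powR ?nnegrE ?ltW//; lra.
  have -> : A - D * a + D * ((c + d) / 2) = A + D * ((c + d) / 2 - a) by lra.
  rewrite [(_ * (A + _)) `^ _]powRM ?(ltW h0)//; last first.
    (* Written as a convex combination of [A] and [B], the chord value is visibly nonnegative. *)
    have -> : A + D * ((c + d) / 2 - a) =
      (A * (b - (c + d) / 2) + B * ((c + d) / 2 - a)) / (b - a).
      by rewrite /D; field; rewrite gt_eqF.
    have cb : 0 <= b - (c + d) / 2 by lra.
    have ca : 0 <= (c + d) / 2 - a by lra.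
    exact: divr_ge0 (addr_ge0 (mulr_ge0 A0 cb) (mulr_ge0 B0 ca)) (ltW ba0).
  rewrite -/(gen_log_mean p a b) -[X in _ <= X * _ * _]hE.
  by rewrite le_eqVlt; apply/orP; left; apply/eqP; ring.
have [am mb] : a <= m /\ m <= b by rewrite /m; split; lra.
have h1 := half a m (2 * a + b) ltac:(lra) ltac:(rewrite /m; lra) (lexx a) mb.
have h2 := half m b (a + 2 * b) ltac:(rewrite /m; lra) ltac:(lra) am (lexx b).
have quarter (X : R) : 0 <= X -> (X / 4) `^ q^-1 = (4 `^ q^-1)^-1 * X `^ q^-1.
  move=> X0; rewrite powRM ?invr_ge0// mulrC; congr (_ * _).
  by rewrite -(@powR_inv1 _ 4)// -powRrM mulN1r powRN.
(* The midpoints of the two halves are the quarter points of [[a, b]], whence the weights 3 and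
   1. *)
have E1 : A + D * ((a + m) / 2 - a) = (B + 3 * A) / 4.
  by rewrite /D /m; field; rewrite gt_eqF.
have E2 : A + D * ((m + b) / 2 - a) = (A + 3 * B) / 4.
  by rewrite /D /m; field; rewrite gt_eqF.
rewrite E1 quarter in h1; last by lra.
rewrite E2 quarter in h2; last by lra.
rewrite intE.
(* At [m] the two increments contribute [(a - b) f m], which the factor [1 / (2 (b - a))] turns into
   [- f m / 2]. *)
have -> : (b - a)^-1 * (F b - F a) + (a * f b - b * f a) / (2 * (b - a)) -
    2^-1 * f ((a + b) / 2) = (2 * (b - a))^-1 *
    ((2 * (F m - F a) + (a * f m - b * f a)) +
     (2 * (F b - F m) + (a * f b - b * f m))).
  by rewrite -/m; field; rewrite gt_eqF.
have ba20 : 0 < 2 * (b - a) by rewrite mulr_gt0.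
rewrite normrM normfV (gtr0_norm ba20) [leLHS]mulrC (ler_pdivrMr _ _ ba20).
apply: le_trans (ler_normD _ _) (le_trans (lerD h1 h2) _).
rewrite (_ : 4 `^ (1 + q^-1) = 4 * 4 `^ q^-1); last first.
  by rewrite powRD ?powRr1// pnatr_eq0 implybT.
have alg (e r L x y : R) : 0 < r -> e / 2 * L * (r^-1 * x) +
    e / 2 * L * (r^-1 * y) = (4 * r)^-1 * L * (x + y) * (2 * e).
  by move=> r0; field; rewrite gt_eqF.
by rewrite alg ?powR_gt0.
Qed.
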